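(* Let $\pi$ be a $d^p$ probability tensor (i.e. $d_1=\dots=d_p=d$) generated by a weakly hierarchical log-linear model with parameters $\theta$, and let $V=\{1,\dots,p\}$. For a permutation $\sigma$ of $V$ and each $j=1,\dots,p-1$, put $G_\sigma^{(j)}=\{\sigma(j+1),\dots,\sigma(p)\}$ and $$B_{\sigma(j)}=\{\, i_{\sigma(j)}\in\mathcal I_{\sigma(j)} : \text{there exist } f\in G_\sigma^{(j)} \text{ and } i_f\in\mathcal I_f \text{ such that } \theta_{\{\sigma(j),f\}}(i_{\sigma(j)},i_f)\neq 0\,\}.$$ Then $$\mathrm{rnk}^+_P(\pi)\;\le\;\min_{\sigma}\ \prod_{j=1}^{p-1}\bigl(|B_{\sigma(j)}|+1\bigr),$$ where the minimum is over all permutations $\sigma$ of $V$.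
   Context: Notation. $V=\{1,\dots,p\}$ indexes categorical variables $y_1,\dots,y_p$; $y_j$ takes values in $\mathcal I_j=\{1,\dots,d_j\}$. For $E\subset V$, $\mathcal I_E=\prod_{j\in E}\mathcal I_j$, and for $\boldsymbol i=(i_1,\dots,i_p)\in\mathcal I_V$, $\boldsymbol i_E=(i_j)_{j\in E}$. A probability tensor is an array $\pi=(\pi_{\boldsymbol i})_{\boldsymbol i\in\mathcal I_V}$ of nonnegative numbers summing to one, with $\pi_{i_1\dots i_p}=\Pr(y_1=i_1,\dots,y_p=i_p)$. Log-linear model. $\pi$ is generated by (corresponds to) a log-linear model with real parameters $\theta=\{\theta_E(\boldsymbol i_E)\}$ if $\log \pi_{\boldsymbol i}=\sum_{E\subset V}\theta_E(\boldsymbol i_E)$ for all $\boldsymbol i\in\mathcal I_V$, with the corner parameterization: $\theta_E(\boldsymbol i_E)=0$ whenever $i_j=1$ for some $j\in E$. Weakly hierarchical. The model is weakly hierarchical if: whenever $\theta_E(\boldsymbol i_E)=0$ for some $E\subset V$ and $\boldsymbol i_E\in\mathcal I_E$, then $\theta_F(\boldsymbol i'_F)=0$ for every $F\supseteq E$ and every $\boldsymbol i'_F\in\mathcal I_F$ with $i'_j=i_j$ for all $j\in E$. Nonnegative PARAFAC rank. For a nonnegative tensor $M\in\mathbb R^{d_1\times\dots\times d_p}$, $\mathrm{rnk}^+_P(M)$ is the least $m$ such that $M=\sum_{h=1}^m \lambda_h^{(1)}\otimes\dots\otimes\lambda_h^{(p)}$ with nonnegative vectors $\lambda_h^{(j)}\in\mathbb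 R^{d_j}$, where $\otimes$ is the outer product, $(\lambda^{(1)}\otimes\dots\otimes\lambda^{(p)})_{i_1\dots i_p}=\prod_j\lambda^{(j)}_{i_j}$. *)

(* Defs.v *)
From mathcomp Require Import all_boot all_order all_algebra all_fingroup.
From mathcomp Require Import boolp reals exp.

Set Implicit Arguments.
Unset Strict Implicit.
Unset Printing Implicit Defensive.

Import Order.TTheory GRing.Theory Num.Theory.
Local Open Scope ring_scope.

(* Everything is shifted to start at 0: V = {1, ..., p} is 'I_p, the levels
   {1, ..., d} are 'I_d, and the baseline level 1 is the ordinal of value 0. *)
Definition cell (p d : nat) : finType := {ffun 'I_p -> 'I_d}.

Definition mcell (p d : nat) (E : {set 'I_p}) : finType :=
  {ffun {j : 'I_p | j \in E} -> 'I_d}.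

Definition restr (p d : nat) (E : {set 'I_p}) (i : cell p d) : mcell d E :=
  [ffun j : {j : 'I_p | j \in E} => i (val j)].

(* The marginal cell with level x at a and level y at f, meant for a != f. *)
Definition pair_mcell (p d : nat) (a f : 'I_p) (x y : 'I_d) :
    mcell d [set a; f] :=
  [ffun j : {j : 'I_p | j \in [set a; f]} => if val j == a then x else y].

Section Tensors.
Variables (R : realType) (p d : nat).

Definition tensor := cell p d -> R.

Definition nonneg_tensor (M : tensor) : Prop := forall i, 0 <= M i.

Definition probability_tensor (M : tensor) : Prop :=
  nonneg_tensor M /\ \sum_(i : cell p d) M i = 1.

Lemma probability_tensor_ge0 (M : tensor) :
  probability_tensor M -> nonneg_tensor M.
Proof. by case. Qed.

Definition outer (v : 'I_p -> 'rV[R]_d) : tensor :=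
  fun i => \prod_(j < p) v j 0 (i j).

Definition nn_parafac (M : tensor) (m : nat) : Prop :=
  exists lambda : 'I_m -> 'I_p -> 'rV[R]_d,
    (forall h j k, 0 <= lambda h j 0 k) /\
    (forall i, M i = \sum_(h < m) outer (lambda h) i).

(* For p = 0 this fails: an empty outer product is 1, so only integers would
   have a decomposition. *)
Lemma nn_parafac_exists (M : tensor) :
  (0 < p)%N -> nonneg_tensor M -> exists m, `[< nn_parafac M m >].
Proof.
move=> p_gt0 M_ge0; exists #|cell p d|; apply/asboolP.
pose j0 := Ordinal p_gt0.
exists (fun h j => \row_k ((if j == j0 then M (enum_val h) else 1)
                           * (k == enum_val h j)%:R)); split.
  by move=> h j k; rewrite mxE mulr_ge0 ?ler0n //; case: ifP.
move=> i; rewrite (bigD1 (enum_rank i)) //= big1 ?addr0 => [|h neq_h].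
  rewrite /outer (bigD1 j0) //= big1 => [|j /negPf jj0].
    by rewrite mxE enum_rankK !eqxx !mulr1.
  by rewrite mxE enum_rankK jj0 eqxx mulr1.
have [j neq_j] : exists j, i j != enum_val h j.
  apply/existsP; apply: contraR neq_h => /existsPn eq_i.
  have -> : i = enum_val h by apply/ffunP => j; apply/eqP/negPn/eq_i.
  by rewrite enum_valK.
by rewrite /outer (bigD1 j) //= mxE (negPf neq_j) mulr0 mul0r.
Qed.

Definition nn_parafac_rank (p_gt0 : (0 < p)%N) (M : tensor)
    (M_ge0 : nonneg_tensor M) : nat :=
  ex_minn (nn_parafac_exists p_gt0 M_ge0).

Definition loglinear_parameters := forall E : {set 'I_p}, mcell d E -> R.

Definition corner_parameterization (theta : loglinear_parameters) : Prop :=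
  forall (E : {set 'I_p}) (c : mcell d E),
    (exists j, c j = 0%N :> nat) -> theta E c = 0.

(* Positivity is required explicitly because ln is 0 on nonpositive reals. *)
Definition generated_by (M : tensor) (theta : loglinear_parameters) : Prop :=
  corner_parameterization theta /\
  (forall i, 0 < M i /\
             ln (M i) = \sum_(E : {set 'I_p}) theta E (restr E i)).

Definition weakly_hierarchical (theta : loglinear_parameters) : Prop :=
  forall (E F : {set 'I_p}) (c : mcell d E) (c' : mcell d F),
    E \subset F ->
    (forall (u : {j | j \in E}) (v : {j | j \in F}),
       val u = val v -> c' v = c u) ->
    theta E c = 0 -> theta F c' = 0.

Definition later (s : 'S_p) (j : 'I_p) : {set 'I_p} :=
  [set s k | k : 'I_p & (j < k)%N].

Definition Bset (theta : loglinear_parameters) (s : 'S_p) (j : 'I_p) :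
    {set 'I_d} :=
  [set x | [exists f in later s j,
     exists y : 'I_d, theta [set s j; f] (pair_mcell (s j) f x y) != 0]].

(* The condition j.+1 < p drops the last position of the ordering. *)
Definition Bprod (theta : loglinear_parameters) (s : 'S_p) : nat :=
  (\prod_(j < p | j.+1 < p) (#|Bset theta s j| + 1))%N.

(* minn has no neutral element; the default is the value at the identity. *)
Definition min_Bprod (theta : loglinear_parameters) : nat :=
  \big[minn/Bprod theta 1%g]_(s : 'S_p) Bprod theta s.

End Tensors.

(* Main.v *)
(** Fix an ordering [s] of the variables and record, for each variable, its
    level if that level lies in [B], and [None] otherwise.  By weak hierarchy,
    a nonzero [theta_E (i_E)] forces the level of every variable of [E] but the
    last one to lie in [B].  So once all the records are fixed, [theta_E (i_E)]
    depends only on the level of the last variable of [E]; the restriction of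
    [pi] to the cells with these records then has rank at most one.  The bound
    counts the tuples of records. *)

Require Import Defs.
From mathcomp Require Import all_boot all_order all_algebra all_fingroup.
From mathcomp Require Import boolp reals sequences exp.

Set Implicit Arguments.
Unset Strict Implicit.
Unset Printing Implicit Defensive.

Import Order.TTheory GRing.Theory Num.Theory.
Local Open Scope ring_scope.

Lemma nn_parafac_sum (R : realType) (p d : nat) (H : finType) (A : {pred H})
    (lambda : H -> 'I_p -> 'rV[R]_d) (M : tensor R p d) :
  (forall h k x, 0 <= lambda h k 0 x) ->
  (forall i, M i = \sum_(h in A) outer (lambda h) i) ->
  nn_parafac M #|A|.
Proof.
move=> lambda_ge0 ME; exists (fun n => lambda (enum_val n)).
by split=> [n|i]; [exact: lambda_ge0 | rewrite ME big_enum_val].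
Qed.

(** One summand per tuple [h] of classes. On the cells with classes [h], grouping the [e] by [l e]
    turns the exponential of the sum into a product of one-variable factors; indicators in the
    factors kill all other cells. *)
Lemma nn_parafac_expR_sum (R : realType) (p d : nat) (C J : finType)
    (cl : 'I_p -> 'I_d -> C) (phi : J -> cell p d -> R) (l : J -> 'I_p)
    (M : tensor R p d) :
  (forall e (i i' : cell p d), (forall k, cl k (i k) = cl k (i' k)) ->
     i (l e) = i' (l e) -> phi e i = phi e i') ->
  (forall i, M i = expR (\sum_e phi e i)) ->
  nn_parafac M (\prod_k #|cl k @: 'I_d|).
Proof.
move=> phi_l ME.
(* By hypothesis the cell picked is immaterial. The default 0 never matters: a cell with classes [h]
   is its own witness, and other cells meet a zero indicator. *)
pose g (h : {ffun 'I_p -> C}) e x :=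
  if [pick i : cell p d | [forall k, cl k (i k) == h k] && (i (l e) == x)]
  is Some i then phi e i else 0.
have gE (h : {ffun 'I_p -> C}) (i : cell p d) e :
  (forall k, cl k (i k) = h k) -> g h e (i (l e)) = phi e i.
  move=> cl_i; rewrite /g; case: pickP => [i' /andP[/forallP cl_i' /eqP]|].
    by apply: phi_l => k; rewrite cl_i; exact/eqP.
  move=> /(_ i) /negbT; rewrite eqxx andbT => /forallPn[k].
  by rewrite cl_i eqxx.
pose lambda (h : {ffun 'I_p -> C}) k := \row_x
  ((cl k x == h k)%:R * expR (\sum_(e | l e == k) g h e x)).
have -> : (\prod_k #|cl k @: 'I_d|)%N = #|family (fun k => mem (cl k @: 'I_d))|.
  by rewrite card_family foldrE big_map big_enum.
apply: (nn_parafac_sum (lambda := lambda)) => [h k x|i].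
  by rewrite mxE mulr_ge0 ?ler0n ?expR_ge0.
pose h0 := [ffun k => cl k (i k)].
rewrite (bigD1 h0) /=; last by apply/familyP => k; rewrite ffunE imset_f.
rewrite big1 ?addr0 => [|h /andP[_ neq_h]].
  rewrite ME (partition_big l xpredT) //= expR_sum; apply: eq_bigr => k _.
  rewrite mxE ffunE eqxx mul1r; congr expR.
  by apply: eq_bigr => e /eqP <-; rewrite gE // => k'; rewrite ffunE.
have [k neq_k] : exists k, cl k (i k) != h k.
  apply/existsP; apply: contraR neq_h => /existsPn eq_h.
  by apply/eqP/ffunP => k; rewrite ffunE; apply/esym/eqP/negPn/eq_h.
by rewrite /outer (bigD1 k) //= mxE (negPf neq_k) !mul0r.
Qed.

(** [Bset] is indexed by positions in the ordering, hence [s^-1]. *)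
Definition level_record (R : realType) (p d : nat)
    (theta : loglinear_parameters R p d) (s : 'S_p) (k : 'I_p) (x : 'I_d) :
    option 'I_d :=
  if x \in Bset theta s (s^-1%g k) then Some x else None.

(** Otherwise the pair term of [k] and the later [l] vanishes at these levels, and weak hierarchy
    carries the zero up to [E]. *)
Lemma mem_Bset (R : realType) (p d : nat) (theta : loglinear_parameters R p d)
    (s : 'S_p) (E : {set 'I_p}) (i : cell p d) (k l : 'I_p) :
  weakly_hierarchical theta -> k \in E -> l \in E ->
  (s^-1%g k < s^-1%g l)%N -> theta E (restr E i) != 0 ->
  i k \in Bset theta s (s^-1%g k).
Proof.
move=> theta_wh kE lE lt_kl; apply: contraR.
rewrite inE permKV => /existsPn/(_ l); rewrite negb_and => /orP[/negP[]|].
  by apply/imsetP; exists (s^-1%g l); rewrite ?inE ?permKV.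
move=> /existsPn/(_ (i l)) /negPn/eqP theta0; apply/eqP.
apply: theta_wh theta0 => [|u v uv]; first by rewrite subUset !sub1set kE.
rewrite !ffunE uv; case: eqP => [->//|neq].
by case/set2P: (valP u); rewrite -uv in neq * => eq_u //; rewrite eq_u.
Qed.

Lemma theta_last_dependence (R : realType) (p d : nat)
    (theta : loglinear_parameters R p d) (s : 'S_p) (E : {set 'I_p}) :
  (0 < p)%N -> weakly_hierarchical theta ->
  exists l, forall i i' : cell p d,
    (forall k, level_record theta s k (i k) = level_record theta s k (i' k)) ->
    i l = i' l -> theta E (restr E i) = theta E (restr E i').
Proof.
move=> p_gt0 theta_wh; have [->|[k0 k0E]] := set_0Vmem E.
  exists (Ordinal p_gt0) => i i' _ _; congr theta.
  by apply/ffunP => -[k kE]; have := kE; rewrite inE.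
have [l lE l_max] := @arg_maxnP _ k0 (mem E) (fun k => s^-1%g k) k0E.
exists l => i i' eq_rec eq_l.
have last_or_lt k : k \in E -> k = l \/ (s^-1%g k < s^-1%g l)%N.
  move=> kE; have := l_max k kE.
  rewrite /geq /= leq_eqVlt => /orP[/eqP eq_kl|]; last by right.
  by left; apply: (@perm_inj _ s^-1%g); apply: val_inj.
(* Nonvanishing at one cell is enough: its levels before [l] are then recorded, so the other cell
   must share them. By symmetry, only the case of two zeros remains. *)
have agree (j j' : cell p d) : (forall k,
    level_record theta s k (j k) = level_record theta s k (j' k)) ->
    j l = j' l -> theta E (restr E j) != 0 -> restr E j = restr E j'.
  move=> eq_jj' eq_jl nz; apply/ffunP => -[k kE]; rewrite !ffunE /=.
  have [->//|lt_kl] := last_or_lt k kE.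
  have := eq_jj' k; rewrite /level_record (mem_Bset theta_wh kE lE lt_kl nz).
  by case: ifP => // _ [].
have [z|nz] := eqVneq (theta E (restr E i)) 0; last by rewrite (agree i i').
have [z'|nz'] := eqVneq (theta E (restr E i')) 0; first by rewrite z z'.
by rewrite (agree i' i).
Qed.

Lemma leq_prod_card_level_record (R : realType) (p d : nat)
    (theta : loglinear_parameters R p d) (s : 'S_p) :
  (\prod_k #|level_record theta s k @: 'I_d| <= Bprod theta s)%N.
Proof.
rewrite (reindex_inj (@perm_inj _ s)) /Bprod [leqRHS]big_mkcond /=.
apply: leq_prod => j _.
apply: (@leq_trans (#|Bset theta s j| + 1)).
  rewrite -(card_imset _ Some_inj) -(cards1 (@None 'I_d)).
  apply: leq_trans (leq_card_setU _ _).1.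
  apply/subset_leq_card/subsetP => _ /imsetP[x _ ->].
  rewrite /level_record permK; apply/setUP.
  by case: ifP => xB; [left; exact: imset_f | right; exact: set11].
(* [Bprod] omits the last position; no variable comes later there, so its [Bset] is empty and its
   factor is 1. *)
case: ltnP => // le_pj; rewrite -[leqRHS]add0n leq_add2r leqn0 cards_eq0.
apply/eqP/setP => x; rewrite !inE; apply/existsP => -[f /andP[/imsetP[k]]].
by rewrite inE ltnNge -ltnS (leq_trans (ltn_ord k) le_pj).
Qed.

Theorem theorem3p1 (R : realType) (p d : nat) (p_gt0 : (0 < p)%N)
    (pi : tensor R p d) (theta : loglinear_parameters R p d)
    (pi_prob : probability_tensor pi)
    (pi_theta : generated_by pi theta)
    (theta_wh : weakly_hierarchical theta) :
  (nn_parafac_rank p_gt0 (probability_tensor_ge0 pi_prob)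
     <= min_Bprod theta)%N.
Proof.
have rank_le s :
    (nn_parafac_rank p_gt0 (probability_tensor_ge0 pi_prob)
       <= Bprod theta s)%N.
  apply: leq_trans (leq_prod_card_level_record theta s).
  rewrite /nn_parafac_rank; case: ex_minnP => m _; apply; apply/asboolP.
  have [l theta_l] := fin_all_exists
    (fun E => theta_last_dependence s E p_gt0 theta_wh).
  apply: (nn_parafac_expR_sum (phi := fun E i => theta E (restr E i)) theta_l).
  by move=> i; have [pi_gt0 <-] := pi_theta.2 i; rewrite lnK.
(* The default value of the minimum is itself a [Bprod], so [rank_le] covers it too. *)
rewrite /min_Bprod; elim/big_ind: _ => // m n le_m le_n.
by rewrite leq_min le_m.
Qed.
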